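(* Let $A=\mathbb C(S_3)$ with its standard 3-dimensional calculus $\Omega(S_3)$. Then $\Omega(S_3)$ admits precisely two left-invariant flat torsion free bimodule connections $(\nabla,\sigma)$ on $\Omega^1$ obeying the braid relations, given by $q=e^{\pm2\pi i/3}$, namely $$\nabla e_u=\frac1{q-1}\Big(qe_u\otimes e_u+qe_u\otimes(e_v+e_w)+q(e_v+e_w)\otimes e_u+e_v\otimes e_w+e_w\otimes e_v+q^{-1}e_v\otimes e_v+q^{-1}e_w\otimes e_w\Big)$$ and the same for a permutation of $u,v,w$. For the generalised braiding, we have \begin{align*} \sigma(e_u\otimes e_u)&=\tfrac1{1-q}\left(e_u\otimes e_u+q^{-1}e_v\otimes e_v+q^{-1}e_w\otimes e_w\right),\\ \sigma(e_v\otimes e_v)&=\tfrac1{1-q}\left(q^{-1}e_u\otimes e_u+e_v\otimes e_v+q^{-1}e_w\otimes e_w\right),\\ \sigma(e_w\otimes e_w)&=\tfrac1{1-q}\left(q^{-1}e_u\otimes e_u+q^{-1}e_v\otimes e_v+e_w\otimes e_w\right),\\ \sigma(e_u\otimes e_v)&=\tfrac1{1-q}\left(qe_u\otimes e_v+e_v\otimes e_w+e_w\otimes e_u\right),&\sigma(e_v\otimes e_u)&=\tfrac1{1-q}\left(qe_v\otimes e_u+e_w\otimes e_v+e_u\otimes e_w\right),\\ \sigma(e_v\otimes e_w)&=\tfrac1{1-q}\left(qe_v\otimes e_w+e_w\otimes e_u+e_u\otimes e_v\right),&\sigma(e_w\otimes e_v)&=\tfrac1{1-q}\left(qe_w\otimes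 e_v+e_u\otimes e_w+e_v\otimes e_u\right),\\ \sigma(e_w\otimes e_u)&=\tfrac1{1-q}\left(qe_w\otimes e_u+e_u\otimes e_v+e_v\otimes e_w\right),&\sigma(e_u\otimes e_w)&=\tfrac1{1-q}\left(qe_u\otimes e_w+e_v\otimes e_u+e_w\otimes e_v\right). \end{align*} These two connections are extendable, $\wedge$-compatible and Leibniz compatible (so that they are torsion free, flat, $\wedge$-compatible, extendable and Leibniz compatible).
   Context: $S_3$ is the permutation group on 3 elements, $u=(12)$, $v=(23)$, $w=uvu=vuv=(13)$; $A=\mathbb C(S_3)$ is the algebra of complex functions on $S_3$ and $R_x(f)(g)=f(gx)$. $\Omega^1$ is the free left $A$-module with (left-invariant) basis $e_u,e_v,e_w$, with bimodule relations $e_af=R_a(f)e_a$ and $\mathrm df=\sum_{a\in\{u,v,w\}}(R_a(f)-f)e_a$. In degree 2 the exterior algebra $\Omega$ has the relations $e_a^2=0$ ($a=u,v,w$), $e_u\wedge e_v+e_v\wedge e_w+e_w\wedge e_u=0$, $e_v\wedge e_u+e_w\wedge e_v+e_u\wedge e_w=0$, and $\mathrm d=[\theta,\ \}$ (graded commutator) with $\theta=e_u+e_v+e_w$, so that $\mathrm de_u=-e_v\wedge e_w-e_w\wedge e_v$, $\mathrm de_v=-e_w\wedge e_u-e_u\wedge e_w$, $\mathrm de_w=-e_u\wedge e_v-e_v\wedge e_u$. A bimodule connection $(\nabla,\sigma)$ on $\Omega^1$ is a linear map $\nabla:\Omega^1\to\Omega^1\otimes_A\Omega^1$ and a bimodule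 map $\sigma:\Omega^1\otimes_A\Omega^1\to\Omega^1\otimes_A\Omega^1$ (the generalised braiding) with $\nabla(f\omega)=\mathrm df\otimes\omega+f\nabla\omega$ and $\nabla(\omega f)=(\nabla\omega)f+\sigma(\omega\otimes\mathrm df)$ for all $f\in A$, $\omega\in\Omega^1$. It is left-invariant if $\nabla$ commutes with the left translation action of $S_3$ (acting on functions by left translation and trivially on the $e_a$), i.e. each $\nabla e_a$ has constant coefficients in the basis $e_b\otimes e_c$. Lower indices indicate position: $\wedge_i,\sigma_i$ act in tensor factors $i,i+1$. Torsion free: $\wedge\nabla=\mathrm d$ on $\Omega^1$. Flat: $(\mathrm d\otimes\mathrm{id}-\mathrm{id}\wedge\nabla)\nabla=0$. Braid relations: $\sigma_1\sigma_2\sigma_1=\sigma_2\sigma_1\sigma_2$ on $\Omega^1\otimes_A\Omega^1\otimes_A\Omega^1$. Extendable: $\omega\otimes\eta\wedge\zeta\mapsto\wedge_1\sigma_2\sigma_1(\omega\otimes\eta\otimes\zeta)$ is a well-defined bimodule map $\Omega^1\otimes_A\Omega^2\to\Omega^2\otimes_A\Omega^1$. $\wedge$-compatible: $\nabla_{\Omega^2}(\eta\wedge\omega):=(\nabla\eta)\wedge\omega+\wedge_2\sigma_1(\eta\otimes\nabla\omega)$ is a well-defined bimodule connection on $\Omega^2$. Leibniz compatible: $\nabla_2\sigma_1=\sigma_2\nabla_2$ on $\Omega^1\otimes_A\Omega^1$, where $\nabla_2=\nabla\otimes\mathrm{id}+\sigma_1(\mathrm{id}\otimes\nabla)$.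
   Formalization: ''Precisely two'' is proved for connections that are also extendable; without this it is false: with θ=e_u+e_v+e_w, ∇e_a=e_a⊗θ+θ⊗e_a−(1/3)θ⊗θ is a further left-invariant flat torsion free bimodule connection obeying the braid relations. *)

(* Defs.v *)
From HB Require Import structures.
From mathcomp Require Import all_boot all_algebra perm.
From mathcomp Require Import complex reals trigo.

Set Implicit Arguments.
Unset Strict Implicit.
Unset Printing Implicit Defensive.

Import GRing.Theory.
Local Open Scope ring_scope.

Declare Scope calculus_scope.
Delimit Scope calculus_scope with calc.
Reserved Notation "m ⊗ n" (at level 40, left associativity).

(* ------------------------------------------------------------------------ *)
(* The points permuted by S_3 are 0, 1, 2 instead of 1, 2, 3.                *)

Definition pt0 : 'I_3 := @Ordinal 3 0 isT.
Definition pt1 : 'I_3 := @Ordinal 3 1 isT.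
Definition pt2 : 'I_3 := @Ordinal 3 2 isT.

Inductive refl := U | V | W.

Definition perm_of_refl (a : refl) : 'S_3 :=
  match a with
  | U => tperm pt0 pt1
  | V => tperm pt1 pt2
  | W => tperm pt0 pt2
  end.

Definition refl_code (a : refl) : 'I_3 :=
  match a with U => pt0 | V => pt1 | W => pt2 end.
Definition refl_decode (i : 'I_3) : refl :=
  match val i with 0 => U | 1 => V | _ => W end.
Lemma refl_codeK : cancel refl_code refl_decode. Proof. by case. Qed.
HB.instance Definition _ := Countable.copy refl (can_type refl_codeK).
Lemma refl_enumP : Finite.axiom [:: U; V; W]. Proof. by case. Qed.
HB.instance Definition _ := isFinite.Build refl refl_enumP.

(* ------------------------------------------------------------------------ *)
(* A finite set labelled by elements of S_3 presents the free left           *)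
(* A-module on it, with the bimodule relations e_i f = R_(wt i)(f) e_i.      *)

Record gbasis := GBasis { gindex :> finType; wt : gindex -> 'S_3 }.

(* e_i ⊗ e_j f = R_(wt i)(R_(wt j)(f)) e_i ⊗ e_j = R_(wt i * wt j)(f) e_i ⊗ e_j *)
Definition gtens (E F : gbasis) : gbasis :=
  @GBasis (E * F)%type (fun p => (wt p.1 * wt p.2)%g).

Definition X1 : gbasis := @GBasis refl perm_of_refl.
Definition X2 : gbasis := gtens X1 X1.
Definition X3 : gbasis := gtens X1 X2.

Lemma wt_vw : wt ((V, W) : X2) = wt ((U, V) : X2).
Proof. by apply/permP=> -[[|[|[|//]]] i]; rewrite /= !permM !permE. Qed.

Lemma wt_wu : wt ((W, U) : X2) = wt ((U, V) : X2).
Proof. by apply/permP=> -[[|[|[|//]]] i]; rewrite /= !permM !permE. Qed.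

Lemma wt_wv : wt ((W, V) : X2) = wt ((V, U) : X2).
Proof. by apply/permP=> -[[|[|[|//]]] i]; rewrite /= !permM !permE. Qed.

Lemma wt_uw : wt ((U, W) : X2) = wt ((V, U) : X2).
Proof. by apply/permP=> -[[|[|[|//]]] i]; rewrite /= !permM !permE. Qed.

(* The four products of basis 1-forms kept as a left basis of Omega^2; the   *)
(* remaining ones are e_w e_u = - e_u e_v - e_v e_w,                         *)
(* e_u e_w = - e_v e_u - e_w e_v and e_a e_a = 0.                            *)
Inductive refl2 := UV | VW | VU | WV.

Definition pair_of_refl2 (p : refl2) : refl * refl :=
  match p with UV => (U, V) | VW => (V, W) | VU => (V, U) | WV => (W, V) end.
Definition refl2_of_pair (p : refl * refl) : refl2 :=
  match p with
  | (U, V) => UV | (V, W) => VW | (V, U) => VU | _ => WV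
  end.
Lemma pair_of_refl2K : cancel pair_of_refl2 refl2_of_pair.
Proof. by case. Qed.
HB.instance Definition _ := Countable.copy refl2 (can_type pair_of_refl2K).
Lemma refl2_enumP : Finite.axiom [:: UV; VW; VU; WV]. Proof. by case. Qed.
HB.instance Definition _ := isFinite.Build refl2 refl2_enumP.

Definition Y2 : gbasis := @GBasis refl2 (fun p => @wt X2 (pair_of_refl2 p)).

Section Calculus.
Variable K : fieldType.
Implicit Types E F G : gbasis.

Definition fn := {ffun 'S_3 -> K}.
HB.instance Definition _ := GRing.PzRing.on fn.
Lemma fn_mulC : @commutative fn fn *%R.
Proof. by move=> f g; apply/ffunP=> h; rewrite !ffunE mulrC. Qed.
HB.instance Definition _ := GRing.PzRing_hasCommutativeMul.Build fn fn_mulC.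
Lemma fn_oner_neq0 : (1 : fn) != 0.
Proof. by apply/eqP=> /ffunP/(_ 1%g)/eqP; rewrite !ffunE oner_eq0. Qed.
HB.instance Definition _ := GRing.PzSemiRing_isNonZero.Build fn fn_oner_neq0.

Definition cst (c : K) : fn := [ffun _ => c].
Definition rtrans (x : 'S_3) (f : fn) : fn := [ffun g : 'S_3 => f (g * x)%g].
Definition ltrans (h : 'S_3) (f : fn) : fn := [ffun g : 'S_3 => f (h^-1 * g)%g].

(* [f *: m] is the left action of the ring [fn]. *)
Definition bmod (E : gbasis) := {ffun E -> fn^o}.

Definition ract E (m : bmod E) (f : fn) : bmod E :=
  [ffun i => (m i : fn) * rtrans (wt i) f].
Definition elt E (i : E) : bmod E := [ffun j => (j == i)%:R].
Definition lact_S3 E (h : 'S_3) (m : bmod E) : bmod E :=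
  [ffun i => ltrans h (m i)].

Definition bimod_map E F (phi : bmod E -> bmod F) : Prop :=
  [/\ forall m n, phi (m + n) = phi m + phi n,
      forall (f : fn) m, phi (f *: m) = f *: phi m
    & forall m f, phi (ract m f) = ract (phi m) f].

(* The tensor product over A; see [tens_balanced], [tliftD], [tlift_tens]    *)
(* and [tens_span] for its universal property.                               *)
Definition tens E F (m : bmod E) (n : bmod F) : bmod (gtens E F) :=
  [ffun p => (m p.1 : fn) * rtrans (wt p.1) (n p.2)].

Definition balanced E F (T : zmodType) (b : bmod E -> bmod F -> T) : Prop :=
  [/\ forall m m' n, b (m + m') n = b m n + b m' n,
      forall m n n', b m (n + n') = b m n + b m n'
    & forall m (f : fn) n, b (ract m f) n = b m (f *: n)].

(* The additive map with m ⊗ n |-> b m n, for a balanced b. For a bimodule   *)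
(* connection (nab, sig), the maps b used in [flat] and [nabla2] are         *)
(* balanced although m ⊗ n |-> m ⊗ nab n alone is not.                       *)
Definition tlift E F (T : zmodType) (b : bmod E -> bmod F -> T)
    (x : bmod (gtens E F)) : T :=
  \sum_(p : E * F) b ((x p : fn) *: elt p.1) (elt p.2).

Definition tmap E F E' F' (phi : bmod E -> bmod E') (psi : bmod F -> bmod F')
    : bmod (gtens E F) -> bmod (gtens E' F') :=
  tlift (fun m n => tens (phi m) (psi n)).

Definition tassoc E F G (x : bmod (gtens (gtens E F) G)) :
    bmod (gtens E (gtens F G)) :=
  [ffun p => x ((p.1, p.2.1), p.2.2)].
Definition tassocV E F G (x : bmod (gtens E (gtens F G))) :
    bmod (gtens (gtens E F) G) :=
  [ffun p => x (p.1.1, (p.1.2, p.2))].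

Local Notation "m ⊗ n" := (tens m n).

Definition Omega1 := bmod X1.
Definition Omega11 := bmod X2.
Definition Omega2 := bmod Y2.

Definition e (a : refl) : Omega1 := @elt X1 a.

Definition d0 (f : fn) : Omega1 :=
  [ffun a : X1 => rtrans (perm_of_refl a) f - f].

(* The quotient of Omega11 by the degree 2 relations; see [wedge_rel],       *)
(* [wedge_ker] and [wedge_surj].                                             *)
Definition wedge (x : Omega11) : Omega2 :=
  [ffun p : Y2 => match p with
    | UV => x (U, V) - x (W, U)
    | VW => x (V, W) - x (W, U)
    | VU => x (V, U) - x (U, W)
    | WV => x (W, V) - x (U, W)
    end].

Definition theta : Omega1 := e U + e V + e W.
Definition d1 (w : Omega1) : Omega2 := wedge (theta ⊗ w) + wedge (w ⊗ theta).

(* All threefold tensor products are bracketed to the right. *)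
Definition sigma1 (sig : Omega11 -> Omega11) (x : bmod X3) : bmod X3 :=
  tassoc (tmap sig (@id Omega1) (tassocV x)).
Definition sigma2 (sig : Omega11 -> Omega11) : bmod X3 -> bmod X3 :=
  tmap (@id Omega1) sig.
Definition wedge1 (x : bmod X3) : bmod (gtens Y2 X1) :=
  tmap wedge (@id Omega1) (tassocV x).
Definition wedge2 : bmod X3 -> bmod (gtens X1 Y2) :=
  tmap (@id Omega1) wedge.

Record bimod_connection E (nab : bmod E -> bmod (gtens X1 E))
    (sig : bmod (gtens E X1) -> bmod (gtens X1 E)) : Prop := {
  conn_linear : forall (c : K) m n,
    nab (cst c *: m + n) = cst c *: nab m + nab n;
  conn_left : forall (f : fn) m, nab (f *: m) = d0 f ⊗ m + f *: nab m;
  conn_braiding : bimod_map sig;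
  conn_right : forall m f, nab (ract m f) = ract (nab m) f + sig (m ⊗ d0 f)
}.

Definition left_invariant (nab : Omega1 -> Omega11) : Prop :=
  forall h w, nab (lact_S3 h w) = lact_S3 h (nab w).

Definition torsion_free (nab : Omega1 -> Omega11) : Prop :=
  forall w, wedge (nab w) = d1 w.

Definition flat (nab : Omega1 -> Omega11) : Prop :=
  forall w, tlift (fun r s => d1 r ⊗ s - wedge1 (r ⊗ nab s)) (nab w) = 0.

Definition braid_relations (sig : Omega11 -> Omega11) : Prop :=
  forall x, sigma1 sig (sigma2 sig (sigma1 sig x))
          = sigma2 sig (sigma1 sig (sigma2 sig x)).

Definition extendable (sig : Omega11 -> Omega11) : Prop :=
  exists2 sig2 : bmod (gtens X1 Y2) -> bmod (gtens Y2 X1),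
    bimod_map sig2 &
    forall r s t : Omega1, sig2 (r ⊗ wedge (s ⊗ t))
      = wedge1 (sigma2 sig (sigma1 sig (r ⊗ (s ⊗ t)))).

Definition wedge_compatible (nab : Omega1 -> Omega11)
    (sig : Omega11 -> Omega11) : Prop :=
  exists (nab2 : Omega2 -> bmod (gtens X1 Y2))
         (sig2 : bmod (gtens Y2 X1) -> bmod (gtens X1 Y2)),
    bimod_connection nab2 sig2 /\
    forall r s : Omega1, nab2 (wedge (r ⊗ s))
      = wedge2 (tassoc (nab r ⊗ s)) + wedge2 (sigma1 sig (r ⊗ nab s)).

Definition nabla2 (nab : Omega1 -> Omega11) (sig : Omega11 -> Omega11) :
    Omega11 -> bmod X3 :=
  tlift (fun r s => tassoc (nab r ⊗ s) + sigma1 sig (r ⊗ nab s)).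

Definition leibniz_compatible (nab : Omega1 -> Omega11)
    (sig : Omega11 -> Omega11) : Prop :=
  forall x, nabla2 nab sig (sig x) = sigma2 sig (nabla2 nab sig x).

(* The formula for nabla e_a, with b, c the other two reflections. *)
Definition nabla_rhs (q : K) (a b c : refl) : Omega11 :=
  cst (q - 1)^-1 *:
    (cst q *: (e a ⊗ e a) + cst q *: (e a ⊗ (e b + e c))
     + cst q *: ((e b + e c) ⊗ e a) + e b ⊗ e c + e c ⊗ e b
     + cst q^-1 *: (e b ⊗ e b) + cst q^-1 *: (e c ⊗ e c)).

Record given_by (q : K) (nab : Omega1 -> Omega11) (sig : Omega11 -> Omega11) :
    Prop := {
  nab_e : forall a b c : refl, uniq [:: a; b; c] ->
    nab (e a) = nabla_rhs q a b c;
  sig_uu : sig (e U ⊗ e U) = cst (1 - q)^-1 *: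
    (e U ⊗ e U + cst q^-1 *: (e V ⊗ e V) + cst q^-1 *: (e W ⊗ e W));
  sig_vv : sig (e V ⊗ e V) = cst (1 - q)^-1 *:
    (cst q^-1 *: (e U ⊗ e U) + e V ⊗ e V + cst q^-1 *: (e W ⊗ e W));
  sig_ww : sig (e W ⊗ e W) = cst (1 - q)^-1 *:
    (cst q^-1 *: (e U ⊗ e U) + cst q^-1 *: (e V ⊗ e V) + e W ⊗ e W);
  sig_uv : sig (e U ⊗ e V) = cst (1 - q)^-1 *:
    (cst q *: (e U ⊗ e V) + e V ⊗ e W + e W ⊗ e U);
  sig_vw : sig (e V ⊗ e W) = cst (1 - q)^-1 *:
    (cst q *: (e V ⊗ e W) + e W ⊗ e U + e U ⊗ e V);
  sig_wu : sig (e W ⊗ e U) = cst (1 - q)^-1 *: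
    (cst q *: (e W ⊗ e U) + e U ⊗ e V + e V ⊗ e W);
  sig_vu : sig (e V ⊗ e U) = cst (1 - q)^-1 *:
    (cst q *: (e V ⊗ e U) + e W ⊗ e V + e U ⊗ e W);
  sig_wv : sig (e W ⊗ e V) = cst (1 - q)^-1 *:
    (cst q *: (e W ⊗ e V) + e U ⊗ e W + e V ⊗ e U);
  sig_uw : sig (e U ⊗ e W) = cst (1 - q)^-1 *:
    (cst q *: (e U ⊗ e W) + e V ⊗ e U + e W ⊗ e V)
}.

(* ------------------------------------------------------------------------ *)

Lemma rtransD x (f g : fn) : rtrans x (f + g) = rtrans x f + rtrans x g.
Proof. by apply/ffunP=> h; rewrite !ffunE. Qed.

Lemma rtransM x (f g : fn) : rtrans x (f * g) = rtrans x f * rtrans x g.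
Proof. by apply/ffunP=> h; rewrite !ffunE. Qed.

Lemma rtrans_nat x n : rtrans x (n%:R : fn) = n%:R.
Proof.
elim: n => [|n IHn]; first by apply/ffunP=> h; rewrite !ffunE.
by rewrite -natr1 rtransD IHn; congr (_ + _); apply/ffunP=> h; rewrite !ffunE.
Qed.

Lemma rtrans_mul x y f : rtrans (x * y)%g f = rtrans x (rtrans y f).
Proof. by apply/ffunP=> h; rewrite !ffunE mulgA. Qed.

Lemma tens_balanced E F : balanced (@tens E F).
Proof.
split=> [m m' n|m n n'|m f n]; apply/ffunP=> p.
- by rewrite !ffunE mulrDl.
- by rewrite !ffunE rtransD mulrDr.
- by rewrite !ffunE rtransM mulrA.
Qed.

Lemma tens_lact E F (f : fn) (m : bmod E) (n : bmod F) :
  (f *: m) ⊗ n = f *: (m ⊗ n).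
Proof. by apply/ffunP=> p; rewrite !ffunE [RHS]mulrA. Qed.

Lemma tens_ract E F (m : bmod E) (n : bmod F) f :
  m ⊗ (ract n f) = ract (m ⊗ n) f.
Proof. by apply/ffunP=> p; rewrite !ffunE rtransM rtrans_mul mulrA. Qed.

Lemma bmod_sum E (m : bmod E) : m = \sum_i (m i : fn) *: elt i.
Proof.
apply/ffunP=> i; rewrite sum_ffunE (bigD1 i) //= !ffunE eqxx big1 => [|j ji].
  by rewrite addr0 [RHS]mulr1.
by rewrite !ffunE eq_sym (negPf ji) [LHS]mulr0.
Qed.

Lemma elt_tens E F (i : E) (j : F) : elt i ⊗ elt j = @elt (gtens E F) (i, j).
Proof.
apply/ffunP=> -[k l]; rewrite !ffunE /= xpair_eqE rtrans_nat.
by case: (k == i); rewrite ?mul0r ?mul1r.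
Qed.

Lemma tens_span E F (x : bmod (gtens E F)) :
  x = \sum_(p : E * F) ((x p : fn) *: elt p.1) ⊗ elt p.2.
Proof.
rewrite {1}[x]bmod_sum; apply: eq_bigr => -[i j] _ /=.
by rewrite tens_lact elt_tens.
Qed.

Section Lift.
Variables (E F : gbasis) (T : zmodType) (b : bmod E -> bmod F -> T).
Hypothesis b_bal : balanced b.

Lemma tliftD x y : tlift b (x + y) = tlift b x + tlift b y.
Proof.
case: b_bal => bDl _ _; rewrite /tlift -big_split; apply: eq_bigr => p _ /=.
by rewrite ffunE scalerDl bDl.
Qed.

Let b0l n : b 0 n = 0.
Proof.
by case: b_bal => bDl _ _; apply: (addrI (b 0 n)); rewrite -bDl !addr0.
Qed.
Let b0r m : b m 0 = 0.
Proof.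
by case: b_bal => _ bDr _; apply: (addrI (b m 0)); rewrite -bDr !addr0.
Qed.

Lemma tlift_tens m n : tlift b (m ⊗ n) = b m n.
Proof.
case: b_bal => bDl bDr bM.
have suml (I : Type) (r : seq I) f n' :
    b (\sum_(i <- r) f i) n' = \sum_(i <- r) b (f i) n'.
  by elim/big_rec2: _ => [|i x y _ <-]; rewrite ?b0l ?bDl.
have sumr (I : Type) (r : seq I) f m' :
    b m' (\sum_(i <- r) f i) = \sum_(i <- r) b m' (f i).
  by elim/big_rec2: _ => [|i x y _ <-]; rewrite ?b0r ?bDr.
rewrite [in RHS](bmod_sum m) [in RHS](bmod_sum n) suml.
under [RHS]eq_bigr do rewrite sumr.
rewrite pair_big; apply: eq_bigr => -[i j] _ /=.
rewrite -bM; congr (b _ _); apply/ffunP=> k; rewrite !ffunE /=.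
case: (eqVneq k i) => [->|_]; first by rewrite [LHS]mulr1 [m i *: _]mulr1.
by rewrite [LHS]mulr0 [m i *: _]mulr0 mul0r.
Qed.

End Lift.

Lemma refl_sum (T : nmodType) (f : refl -> T) : \sum_a f a = f U + f V + f W.
Proof.
by rewrite (bigD1 U) // (bigD1 V) // (bigD1 W) //= big1 ?addr0 ?addrA //; case.
Qed.

Lemma wedge_additive x y : wedge (x + y) = wedge x + wedge y.
Proof. by apply/ffunP=> -[]; rewrite !ffunE opprD addrACA. Qed.

Lemma wedge_lact (f : fn) x : wedge (f *: x) = f *: wedge x.
Proof. by apply/ffunP=> -[]; rewrite !ffunE [RHS]mulrBr. Qed.

Lemma wedge_ract x f : wedge (ract x f) = ract (wedge x) f.
Proof.
apply/ffunP=> -[]; rewrite !ffunE mulrBl; congr (_ - _ * rtrans _ _).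
- exact: wt_wu.
- exact: etrans wt_wu (esym wt_vw).
- exact: wt_uw.
- exact: etrans wt_uw (esym wt_wv).
Qed.

Lemma wedge_bimod_map : @bimod_map X2 Y2 wedge.
Proof.
split; [exact: wedge_additive | exact: wedge_lact | exact: wedge_ract].
Qed.

Lemma wedge_rel :
  [/\ forall a, wedge (e a ⊗ e a) = 0,
      wedge (e U ⊗ e V + e V ⊗ e W + e W ⊗ e U) = 0
    & wedge (e V ⊗ e U + e W ⊗ e V + e U ⊗ e W) = 0].
Proof.
rewrite /e; split=> [a||]; rewrite !elt_tens.
- by apply/ffunP=> -[]; rewrite !ffunE; case: a; rewrite /= subrr.
- by apply/ffunP=> -[]; rewrite !ffunE /= ?(addr0, add0r) ?subrr ?oppr0.
- by apply/ffunP=> -[]; rewrite !ffunE /= ?(addr0, add0r) ?subrr ?oppr0.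
Qed.

Lemma wedge_ker (x : Omega11) : wedge x = 0 ->
  x = \sum_(a : refl) (x (a, a) : fn) *: (e a ⊗ e a)
    + (x (W, U) : fn) *: (e U ⊗ e V + e V ⊗ e W + e W ⊗ e U)
    + (x (U, W) : fn) *: (e V ⊗ e U + e W ⊗ e V + e U ⊗ e W).
Proof.
move=> /ffunP x0.
have := (x0 UV, x0 VW, x0 VU, x0 WV); rewrite !ffunE => -[[[]]].
do 4! [move/eqP; rewrite subr_eq0 => /eqP ?].
have [E EE eE] : exists2 E : refl * refl -> Omega11,
    forall p q, E p q = (q == p)%:R & forall a b, e a ⊗ e b = E (a, b).
  by exists (@elt X2) => [p q|a b]; [rewrite ffunE | rewrite /e elt_tens].
have addE (m n : Omega11) p : (m + n) p = m p + n p by rewrite ffunE.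
have scaleE (f : fn) (m : Omega11) p : (f *: m) p = f * m p by rewrite ffunE.
rewrite refl_sum !eE; apply/ffunP=> -[a b].
rewrite !(addE, scaleE, EE).
by case: a b => [] []; rewrite ?(mulr1, mulr0, addr0, add0r).
Qed.

Lemma wedge_surj (y : Omega2) : exists x, wedge x = y.
Proof.
exists [ffun p : X2 => match p return fn^o with
  | (U, V) => y UV | (V, W) => y VW | (V, U) => y VU | (W, V) => y WV
  | _ => 0 end].
by apply/ffunP=> -[]; rewrite !ffunE subr0.
Qed.

Lemma d1_e :
  [/\ d1 (e U) = - wedge (e V ⊗ e W) - wedge (e W ⊗ e V),
      d1 (e V) = - wedge (e W ⊗ e U) - wedge (e U ⊗ e W)
    & d1 (e W) = - wedge (e U ⊗ e V) - wedge (e V ⊗ e U)].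
Proof.
case: (tens_balanced X1 X1) => bDl bDr _; case: wedge_rel => w0.
rewrite /d1 /theta !bDl !bDr !wedge_additive !w0 !(addr0, add0r) => w1 w2.
have key (a b c d x y : Omega2) : a + b + x = 0 -> c + d + y = 0 ->
    c + b + (a + d) = - x - y.
  move=> /eqP; rewrite addr_eq0 => /eqP <- /eqP; rewrite addr_eq0 => /eqP <-.
  by rewrite [a + d]addrC addrACA addrC [b + a]addrC.
split; last 1 first.
- by apply: key; rewrite addrC addrA addrAC.
- by apply: key; rewrite addrAC.
- by rewrite [RHS]addrC; apply: key.
Qed.

End Calculus.

Notation "m ⊗ n" := (tens m n) : calculus_scope.

Definition expi (R : realType) (t : R) : R[i] := (cos t +i* sin t)%C.

(* Main.v *)
Require Import Defs.
From mathcomp Require Import all_boot all_order all_algebra perm.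
From mathcomp Require Import complex reals trigo ring lra boolp.

(** Put [theta = e U + e V + e W], so that df = theta f - f theta and
    d = [theta, -]. Every bimodule connection [(nab, sig)] on one-forms is inner,

      nab w = theta ⊗ w - sig (w ⊗ theta)            ([connection_inner]),

    because two connections with the same braiding differ by a bimodule map
    from one-forms to their tensor square; such a map preserves the S_3-weight
    of basis elements, which is odd on one side and even on the other. So the
    connection is encoded by the bimodule map [sig] alone, and every condition
    turns into a condition on [sig]:

    - torsion free: sig = - id after [wedge], on the elements w ⊗ theta;
    - Leibniz compatible: follows from the braid relation, since
      nabla2 x = theta ⊗ x - sigma1 sigma2 (x ⊗ theta);
    - flat: the curvature of w is - wedge1 sigma2 sigma1 (w ⊗ theta ⊗ theta),
      so extendability and theta ∧ theta = 0 imply it;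
    - extendable and wedge compatible: if ker wedge = im (1 + sig) and
      wedge sig = - wedge, both follow from the braid relation, which slides
      1 + sig from one pair of legs to the other.

    Existence. For q a primitive cube root of 1 the braiding [sigq] satisfies the
    braid relation (a finite computation), wedge sig = - wedge, and
    sig^2 - sig + 1 = 0 on ker wedge; hence any x in ker wedge is
    (1 + sig) (2 - sig) x / 3, which gives ker wedge = im (1 + sig).

    Uniqueness. Left invariance makes the coefficients of [sig] constant:
    sig (e_a ⊗ e_b) is the sum of M a c d e_c ⊗ e_d over the c, d with c d = a b.
    Torsion freeness leaves one unknown for each a and each of the two
    nontrivial rotations, besides the M a c c. Extendability, tested on
    e_a ⊗ e_b ⊗ e_b, expresses all of them through the t_a = M a a a; tested on
    e_a ⊗ (e_b ⊗ e_a + e_c ⊗ e_b + e_a ⊗ e_c) it forces the t_a to have a common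
    value t with 3 t^2 - 3 t + 1 = 0, that is t = 1 / (1 - q) with
    q^2 + q + 1 = 0 ([coef_classification]). *)

Set Implicit Arguments.
Unset Strict Implicit.
Unset Printing Implicit Defensive.

Import Order.TTheory GRing.Theory Num.Theory.
Local Open Scope ring_scope.
Local Open Scope calculus_scope.

(** * Bimodules with a weighted basis and their tensor products *)

Section AdditiveMaps.
Variables (T T' : zmodType) (phi : T -> T').
Hypothesis phiD : forall x y, phi (x + y) = phi x + phi y.

Lemma addmap0 : phi 0 = 0.
Proof. by apply: (addrI (phi 0)); rewrite -phiD !addr0. Qed.

Lemma addmapN x : phi (- x) = - phi x.
Proof. by apply: (addrI (phi x)); rewrite -phiD !subrr addmap0. Qed.

Lemma addmapB x y : phi (x - y) = phi x - phi y.
Proof. by rewrite phiD addmapN. Qed.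

Lemma addmap_sum (I : Type) (r : seq I) (P : pred I) (F : I -> T) :
  phi (\sum_(i <- r | P i) F i) = \sum_(i <- r | P i) phi (F i).
Proof. by elim/big_rec2: _ => [|i x y _ <-]; rewrite ?addmap0 ?phiD. Qed.

End AdditiveMaps.

Section Bimodules.
Variable K : fieldType.
Implicit Types E F G : gbasis.

Lemma eltE E (i j : E) g : elt K i j g = (j == i)%:R.
Proof. by rewrite ffunE; case: (j == i); rewrite ffunE. Qed.

Lemma bmodDE E (x y : bmod K E) i g : (x + y) i g = x i g + y i g.
Proof. by rewrite ffunE ffunE. Qed.

Lemma bmodNE E (x : bmod K E) i g : (- x) i g = - x i g.
Proof. by rewrite ffunE ffunE. Qed.

Lemma bmodBE E (x y : bmod K E) i g : (x - y) i g = x i g - y i g.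
Proof. by rewrite bmodDE bmodNE. Qed.

Lemma bmodZE E (f : fn K) (x : bmod K E) i g : (f *: x) i g = f g * x i g.
Proof. by rewrite ffunE [LHS]ffunE. Qed.

Lemma ractE E (x : bmod K E) f i g : ract x f i g = x i g * f (g * wt i)%g.
Proof. by rewrite ffunE ffunE ffunE. Qed.

Lemma tensE E F (x : bmod K E) (y : bmod K F) p g :
  (x ⊗ y) p g = x p.1 g * y p.2 (g * wt p.1)%g.
Proof. by rewrite ffunE ffunE ffunE. Qed.

Lemma lactE E h (x : bmod K E) i g : lact_S3 h x i g = x i (h^-1 * g)%g.
Proof. by rewrite ffunE ffunE. Qed.

Lemma bmodP E (x y : bmod K E) : (forall i g, x i g = y i g) -> x = y.
Proof. by move=> xy; apply/ffunP=> i; apply/ffunP=> g. Qed.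

Lemma tensDl E F (m m' : bmod K E) (n : bmod K F) : (m + m') ⊗ n = m ⊗ n + m' ⊗ n.
Proof. by case: (tens_balanced K E F). Qed.

Lemma tensDr E F (m : bmod K E) (n n' : bmod K F) : m ⊗ (n + n') = m ⊗ n + m ⊗ n'.
Proof. by case: (tens_balanced K E F). Qed.

Lemma tens_ract_lact E F (m : bmod K E) f (n : bmod K F) :
  ract m f ⊗ n = m ⊗ (f *: n).
Proof. by case: (tens_balanced K E F). Qed.

Lemma tensBl E F (m m' : bmod K E) (n : bmod K F) : (m - m') ⊗ n = m ⊗ n - m' ⊗ n.
Proof. exact: (addmapB (fun x y => tensDl x y n)). Qed.

Lemma tensBr E F (m : bmod K E) (n n' : bmod K F) : m ⊗ (n - n') = m ⊗ n - m ⊗ n'.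
Proof. exact: (addmapB (tensDr m)). Qed.

Lemma ractD E f (m n : bmod K E) : ract (m + n) f = ract m f + ract n f.
Proof. by apply/ffunP=> i; rewrite !ffunE mulrDl. Qed.

Lemma ractB E f (m n : bmod K E) : ract (m - n) f = ract m f - ract n f.
Proof. exact: (addmapB (@ractD E f)). Qed.

(** Additive maps out of a tensor product are determined by pure tensors: this
    replaces all computations with coordinates of tensor powers. *)
Lemma tens_ext E F (T : zmodType) (phi psi : bmod K (gtens E F) -> T) :
    (forall x y, phi (x + y) = phi x + phi y) ->
    (forall x y, psi (x + y) = psi x + psi y) ->
    (forall m n, phi (m ⊗ n) = psi (m ⊗ n)) ->
  phi =1 psi.
Proof.
move=> phiD psiD phi_psi x; rewrite [x]tens_span !addmap_sum //.
by apply: eq_bigr => p _; rewrite phi_psi.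
Qed.

(** The function [b] of [tlift b] need not be balanced a priori: it is enough
    that it factors through the tensor product. *)
Lemma tlift_factor E F (T : zmodType) (b : bmod K E -> bmod K F -> T)
    (phi : bmod K (gtens E F) -> T) :
    (forall x y, phi (x + y) = phi x + phi y) ->
    (forall m n, b m n = phi (m ⊗ n)) ->
  tlift b =1 phi.
Proof.
move=> phiD b_phi x; rewrite [in RHS](tens_span x) addmap_sum //.
by apply: eq_bigr => p _; rewrite b_phi.
Qed.

Section BimoduleMaps.
Variables (E F : gbasis) (phi : bmod K E -> bmod K F).
Hypothesis phi_bimod : bimod_map phi.

Lemma bimodD m n : phi (m + n) = phi m + phi n.
Proof. by case: phi_bimod. Qed.

Lemma bimodZ f m : phi (f *: m) = f *: phi m.
Proof. by case: phi_bimod. Qed.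

Lemma bimodR m f : phi (ract m f) = ract (phi m) f.
Proof. by case: phi_bimod. Qed.

Lemma bimodB m n : phi (m - n) = phi m - phi n.
Proof. exact: (addmapB bimodD). Qed.

(** The right action on [elt i] is the left action twisted by [R_(wt i)], so
    a nonzero coefficient intertwines two translations of functions, which
    must then be equal. *)
Lemma bimod_map_weight i j : wt i != wt j -> phi (elt K i) j = 0.
Proof.
move=> wt_ij; apply/ffunP=> g; rewrite [RHS]ffunE.
pose f : fn K := [ffun h => (h == g * wt j)%g%:R].
have : phi (ract (elt K i) f) j g = phi (rtrans (wt i) f *: elt K i) j g.
  congr (phi _ _ _); apply/ffunP=> k; rewrite !ffunE.
  case: eqVneq => [->|_]; first by rewrite mul1r [RHS]mulr1.
  by rewrite mul0r [RHS]mulr0.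
rewrite bimodR bimodZ !ffunE eqxx mulr1 (inj_eq (mulgI _)) (negPf wt_ij).
by rewrite mul0r.
Qed.

Lemma bimod_map_sum x j g :
  phi x j g = \sum_i x i g * phi (elt K i) j g.
Proof.
rewrite {1}[x]bmod_sum (addmap_sum bimodD) sum_ffunE sum_ffunE.
by apply: eq_bigr => i _; rewrite bimodZ !ffunE.
Qed.

End BimoduleMaps.

Lemma bimod_map_id E : bimod_map (@id (bmod K E)).
Proof. by []. Qed.

Lemma bimod_map_comp E F G
    (phi : bmod K F -> bmod K G) (psi : bmod K E -> bmod K F) :
  bimod_map phi -> bimod_map psi -> bimod_map (phi \o psi).
Proof.
move=> [pD pZ pR] [qD qZ qR].
by split=> * /=; rewrite ?qD ?qZ ?qR ?pD ?pZ ?pR.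
Qed.

Section TensorMaps.
Variables (E F E' F' : gbasis).
Variables (phi : bmod K E -> bmod K E') (psi : bmod K F -> bmod K F').
Hypotheses (phi_bimod : bimod_map phi) (psi_bimod : bimod_map psi).

Lemma tmap_balanced : balanced (fun m n => phi m ⊗ psi n).
Proof.
split=> *; first by rewrite (bimodD phi_bimod) tensDl.
  by rewrite (bimodD psi_bimod) tensDr.
by rewrite (bimodR phi_bimod) (bimodZ psi_bimod) tens_ract_lact.
Qed.

Lemma tmap_tens m n : tmap phi psi (m ⊗ n) = phi m ⊗ psi n.
Proof. exact: (tlift_tens tmap_balanced). Qed.

Lemma tmap_bimod : bimod_map (tmap phi psi).
Proof.
have tD := tliftD tmap_balanced.
split=> [//|f|x f].
- apply: (tens_ext (phi := fun m => tmap phi psi (f *: m))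
                   (psi := fun m => f *: tmap phi psi m)) => [x y|x y|m n].
  + by rewrite scalerDr [LHS]tD.
  + by rewrite [tmap _ _ _]tD scalerDr.
  + by rewrite -tens_lact !tmap_tens (bimodZ phi_bimod) tens_lact.
- move: x; apply: (tens_ext (phi := fun m => tmap phi psi (ract m f))
                   (psi := fun m => ract (tmap phi psi m) f)) => [x y|x y|m n].
  + by rewrite ractD [LHS]tD.
  + by rewrite [tmap _ _ _]tD ractD.
  + by rewrite -tens_ract !tmap_tens (bimodR psi_bimod) tens_ract.
Qed.

End TensorMaps.

Lemma tassoc_tens E F G (m : bmod K E) (n : bmod K F) (p : bmod K G) :
  tassoc ((m ⊗ n) ⊗ p) = m ⊗ (n ⊗ p).
Proof.
by apply/ffunP=> -[i [j k]]; rewrite !ffunE /= rtransM rtrans_mul mulrA.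
Qed.

Lemma tassocVK E F G : cancel (@tassocV K E F G) (@tassoc K E F G).
Proof. by move=> x; apply/ffunP=> -[i [j k]]; rewrite !ffunE. Qed.

Lemma tassocK E F G : cancel (@tassoc K E F G) (@tassocV K E F G).
Proof. by move=> x; apply/ffunP=> -[[i j] k]; rewrite !ffunE. Qed.

Lemma tassoc_bimod E F G : bimod_map (@tassoc K E F G).
Proof.
by split=> *; apply/ffunP=> -[i [j k]]; rewrite !ffunE //= mulgA.
Qed.

Lemma tassocV_bimod E F G : bimod_map (@tassocV K E F G).
Proof.
by split=> *; apply/ffunP=> -[[i j] k]; rewrite !ffunE //= mulgA.
Qed.

End Bimodules.

Section Legs.
Variable K : fieldType.
Local Notation theta := (theta K).
Local Notation Om1 := (Omega1 K).
Local Notation Om11 := (Omega11 K).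

Lemma wedge1_bimod : bimod_map (@wedge1 K).
Proof.
apply: bimod_map_comp (@tassocV_bimod K X1 X1 X1).
exact: tmap_bimod (wedge_bimod_map K) (@bimod_map_id K X1).
Qed.

Lemma wedge2_bimod : bimod_map (@wedge2 K).
Proof. exact: tmap_bimod (@bimod_map_id K X1) (wedge_bimod_map K). Qed.

Lemma wedge1_tens (x : Om11) (w : Om1) :
  wedge1 (tassoc (x ⊗ w)) = wedge x ⊗ w.
Proof.
rewrite /wedge1 tassocK.
exact: (tmap_tens (wedge_bimod_map K) (@bimod_map_id K X1)).
Qed.

Lemma wedge2_tens (w : Om1) (x : Om11) : wedge2 (w ⊗ x) = w ⊗ wedge x.
Proof. exact: (tmap_tens (@bimod_map_id K X1) (wedge_bimod_map K)). Qed.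

Section Sigma.
Variable sig : Om11 -> Om11.
Hypothesis sig_bimod : bimod_map sig.

Lemma sigma1_bimod : bimod_map (sigma1 sig).
Proof.
apply: bimod_map_comp (@tassoc_bimod K X1 X1 X1) _.
apply: bimod_map_comp (@tassocV_bimod K X1 X1 X1).
exact: tmap_bimod sig_bimod (@bimod_map_id K X1).
Qed.

Lemma sigma2_bimod : bimod_map (sigma2 sig).
Proof. exact: tmap_bimod (@bimod_map_id K X1) sig_bimod. Qed.

Lemma sigma1_tens (x : Om11) (w : Om1) :
  sigma1 sig (tassoc (x ⊗ w)) = tassoc (sig x ⊗ w).
Proof.
rewrite /sigma1 tassocK.
by rewrite (tmap_tens sig_bimod (@bimod_map_id K X1)).
Qed.

Lemma sigma2_tens (w : Om1) (x : Om11) : sigma2 sig (w ⊗ x) = w ⊗ sig x.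
Proof. exact: (tmap_tens (@bimod_map_id K X1) sig_bimod). Qed.

End Sigma.
End Legs.

(** * Inner connections *)

Section InnerConnections.
Variable K : fieldType.
Local Notation theta := (theta K).
Local Notation Om1 := (Omega1 K).
Local Notation Om11 := (Omega11 K).

(** The connection [theta, -] for the commutator twisted by [sig]. It is defined
    on any based bimodule since the induced connection on two-forms, with the
    braiding induced by [sig], also has this form. *)
Definition inner_conn E (sig : bmod K (gtens E X1) -> bmod K (gtens X1 E))
    (w : bmod K E) : bmod K (gtens X1 E) := theta ⊗ w - sig (w ⊗ theta).

Lemma thetaE a g : theta a g = 1.
Proof. by rewrite !bmodDE !eltE; case: a; rewrite /= ?(addr0, add0r). Qed.

Lemma theta_wedge : wedge (theta ⊗ theta) = 0.
Proof.
have tt (p : X2) : (theta ⊗ theta) p = 1.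
  by apply/ffunP=> g; rewrite tensE !thetaE mulr1 ffunE.
by apply/ffunP=> p; rewrite [LHS]ffunE !tt !subrr ffunE; case: p.
Qed.

Lemma d0_theta f : d0 f = ract theta f - f *: theta.
Proof.
apply/ffunP=> a; apply/ffunP=> g; rewrite bmodBE ractE bmodZE !thetaE.
by rewrite mul1r mulr1 !ffunE.
Qed.

Lemma d0_cst c : d0 (cst c) = 0 :> Om1.
Proof. by apply/ffunP=> a; apply/ffunP=> g; rewrite !ffunE subrr. Qed.

(** Since d f = theta f - f theta, the two Leibniz rules for
    theta ⊗ w - sig (w ⊗ theta) amount to [sig] being a bimodule map. *)
Lemma inner_connection E (sig : bmod K (gtens E X1) -> bmod K (gtens X1 E)) :
  bimod_map sig -> bimod_connection (inner_conn sig) sig.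
Proof.
move=> sig_bimod.
have nabD m n : inner_conn sig (m + n) = inner_conn sig m + inner_conn sig n.
  by rewrite /inner_conn tensDr tensDl (bimodD sig_bimod) opprD addrACA.
have nabZ (f : fn K) m :
    inner_conn sig (f *: m) = d0 f ⊗ m + f *: inner_conn sig m.
  rewrite /inner_conn d0_theta tensBl tens_ract_lact !tens_lact.
  by rewrite (bimodZ sig_bimod) scalerBr addrA subrK.
split=> // [c m n|m f].
  by rewrite nabD nabZ d0_cst (addmap0 (fun x y => tensDl x y m)) add0r.
rewrite /inner_conn d0_theta tensBr tens_ract tens_ract_lact tens_ract.
by rewrite (bimodB sig_bimod) (bimodR sig_bimod) ractB addrA subrK.
Qed.

Lemma odd_wt_X1 (a : X1) : perm.odd_perm (wt a) = true.
Proof. by case: a; rewrite /= odd_tperm. Qed.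

Lemma odd_wt_X2 (p : X2) : perm.odd_perm (wt p) = false.
Proof. by case: p => a b; rewrite /= odd_permM !odd_wt_X1. Qed.

(** Two bimodule connections on one-forms with the same braiding differ by a
    bimodule map from one-forms to their tensor square, and there is none but
    zero since the weights of [X1] are odd and those of [X2] even. *)
Lemma connection_inner (nab : Om1 -> Om11) sig :
  bimod_connection nab sig -> nab =1 inner_conn sig.
Proof.
move=> [nabL nabZ sig_bimod nabR] w.
have [_ innerZ _ innerR] := inner_connection sig_bimod.
have nabD m n : nab (m + n) = nab m + nab n.
  have c1 : cst 1 = 1 :> fn K by apply/ffunP=> g; rewrite !ffunE.
  by have := nabL 1 m n; rewrite c1 !scale1r.
have innerD m n : inner_conn sig (m + n) = inner_conn sig m + inner_conn sig n.
  by rewrite /inner_conn tensDr tensDl (bimodD sig_bimod) opprD addrACA.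
pose dif (m : Om1) : Om11 := nab m - inner_conn sig m.
have dif_bimod : @bimod_map K X1 X2 dif.
  rewrite /dif; split=> [m n|f m|m f].
  - by rewrite nabD innerD opprD addrACA.
  - by rewrite nabZ innerZ opprD addrACA subrr add0r [RHS]scalerBr.
  - by rewrite nabR innerR opprD addrACA subrr addr0 [RHS]ractB.
apply/eqP; rewrite -subr_eq0; apply/eqP/ffunP=> p; apply/ffunP=> g.
rewrite -/(dif w) (bimod_map_sum dif_bimod) big1 => [|a _]; first by rewrite !ffunE.
rewrite (bimod_map_weight dif_bimod) ?ffunE ?mulr0 //.
by apply/eqP=> /(congr1 (fun s => perm.odd_perm s)); rewrite odd_wt_X1 odd_wt_X2.
Qed.

(** A bimodule map splitting the projection [wedge]: its values have no component
    on the products e_w ⊗ e_u, e_u ⊗ e_w, e_a ⊗ e_a that the basis of two-forms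
    omits. *)
Definition wedge_lift (y : Omega2 K) : Om11 :=
  [ffun p : X2 => match p return (fn K)^o with
    | (U, V) => y UV | (V, W) => y VW | (V, U) => y VU | (W, V) => y WV
    | _ => 0 end].

Lemma wedge_liftK y : wedge (wedge_lift y) = y.
Proof. by apply/ffunP=> -[]; rewrite !ffunE subr0. Qed.

Lemma wedge_lift_bimod : bimod_map wedge_lift.
Proof.
split=> [x y|f y|y f]; apply/ffunP=> -[a b]; rewrite !ffunE;
  by case: a b => [] []; rewrite ?addr0 ?scaler0 ?mul0r ?ffunE.
Qed.

Section OneForms.
(* Rewriting with additivity must not unfold theta into a sum nor unify
   tensors with sums. *)
#[local] Opaque Defs.theta tens tassoc wedge wedge1 wedge2 sigma1 sigma2.
Variable sig : Om11 -> Om11.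
Hypothesis sig_bimod : bimod_map sig.
Local Notation nab := (inner_conn sig).

Lemma torsion_free_inner :
  torsion_free nab <->
  forall w : Om1, wedge (sig (w ⊗ theta)) = - wedge (w ⊗ theta).
Proof.
have key (w : Om1) : wedge (nab w) = d1 w
    <-> wedge (sig (w ⊗ theta)) = - wedge (w ⊗ theta).
  rewrite /nab (bimodB (wedge_bimod_map K)) /d1.
  by split=> [/addrI <-|->]; rewrite opprK.
by split=> tors w; apply/key.
Qed.

(** With d = [theta, -] the terms r ∧ theta ⊗ s cancel in the curvature of w and
    theta ∧ theta ⊗ w vanishes, leaving minus the image of w ⊗ (theta ⊗ theta)
    under wedge1 sigma2 sigma1; this map factors through
    w ⊗ (theta ∧ theta) = 0. *)
Lemma extendable_flat : extendable sig -> flat nab.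
Proof.
case=> sig2 sig2_bimod sig2E w.
pose curv (x : Om11) :=
  wedge1 (theta ⊗ x) + wedge1 (sigma2 sig (tassoc (x ⊗ theta))).
have s1 := bimodD (sigma1_bimod sig_bimod).
have s2 := bimodD (sigma2_bimod sig_bimod).
have aD := bimodD (@tassoc_bimod K X1 X1 X1).
have w1 := bimodD (@wedge1_bimod K).
rewrite (tlift_factor (phi := curv)) => [|x y|r s].
- have ww := sig2E w theta theta.
  rewrite theta_wedge (addmap0 (tensDr w)) (addmap0 (bimodD sig2_bimod)) in ww.
  rewrite /curv /inner_conn tensBr tensBl (addmapB aD) (addmapB s2) !(addmapB w1).
  rewrite tassoc_tens (sigma2_tens sig_bimod) -(sigma1_tens sig_bimod).
  rewrite tassoc_tens -ww -tassoc_tens wedge1_tens theta_wedge.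
  by rewrite (addmap0 (fun x y => tensDl x y w)) sub0r subr0 addNr.
- rewrite /curv tensDr (tensDl x) aD s2 !w1; exact: addrACA.
- rewrite /curv /d1 /inner_conn tensDl tensBr (addmapB w1).
  rewrite tassoc_tens (sigma2_tens sig_bimod) -!wedge1_tens !tassoc_tens.
  by rewrite opprB [X in _ + X]addrC addrA addrK.
Qed.

(** In nab r ⊗ s + sigma1 (r ⊗ nab s) the terms sig (r ⊗ theta) ⊗ s cancel. *)
Lemma nabla2_inner x :
  nabla2 nab sig x = theta ⊗ x - sigma1 sig (sigma2 sig (tassoc (x ⊗ theta))).
Proof.
have s1 := bimodD (sigma1_bimod sig_bimod).
have s2 := bimodD (sigma2_bimod sig_bimod).
have aD := bimodD (@tassoc_bimod K X1 X1 X1).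
move: x; apply: tlift_factor => [x y|r s].
  by rewrite tensDr (tensDl x) aD s2 s1 opprD addrACA.
rewrite /inner_conn tensBl tensBr (addmapB aD) (addmapB s1) !tassoc_tens.
rewrite (sigma2_tens sig_bimod) -(sigma1_tens sig_bimod) tassoc_tens.
by rewrite addrA subrK.
Qed.

(** Both sides are theta ⊗ sig x minus the two sides of the braid relation
    applied to x ⊗ theta. *)
Lemma braid_leibniz : braid_relations sig -> leibniz_compatible nab sig.
Proof.
move=> braid x; rewrite !nabla2_inner (bimodB (sigma2_bimod sig_bimod)).
by rewrite (sigma2_tens sig_bimod) -(sigma1_tens sig_bimod) braid.
Qed.

Hypothesis sig_braid : braid_relations sig.
Hypothesis ker_wedge : forall x, wedge x = 0 -> exists y, x = y + sig y.
Hypothesis wedge_sig : forall x, wedge (sig x) = - wedge x.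

(** By the braid relation sigma2 sigma1 (1 + sigma2) = (1 + sigma1) sigma2 sigma1,
    where [wedge1] kills im(1 + sigma1) and ker wedge = im(1 + sig). *)
Lemma wedge1_braid (r : Om1) x : wedge x = 0 ->
  wedge1 (sigma2 sig (sigma1 sig (r ⊗ x))) = 0.
Proof.
have wedge1_sigma1 : forall z : bmod K X3, wedge1 (sigma1 sig z) = - wedge1 z.
  move=> z; rewrite -(tassocVK z).
  have s1 := bimodD (sigma1_bimod sig_bimod).
  have w1 := bimodD (@wedge1_bimod K).
  have aD := bimodD (@tassoc_bimod K X1 X1 X1).
  apply: (tens_ext
    (phi := fun t => wedge1 (sigma1 sig (tassoc t)))
    (psi := fun t => - wedge1 (tassoc t))) => [s t|s t|m n].
  - by rewrite aD s1 w1.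
  - by rewrite aD w1 opprD.
  - rewrite (sigma1_tens sig_bimod) !wedge1_tens wedge_sig.
    by rewrite (addmapN (fun x y => tensDl x y n)).
move=> /ker_wedge[y ->]; rewrite tensDr -(sigma2_tens sig_bimod).
rewrite (bimodD (sigma1_bimod sig_bimod)) (bimodD (sigma2_bimod sig_bimod)).
by rewrite (bimodD (@wedge1_bimod K)) -sig_braid wedge1_sigma1 addrN.
Qed.

(** The mirror image: sigma1 sigma2 (1 + sigma1) = (1 + sigma2) sigma1 sigma2. *)
Lemma wedge2_braid x (r : Om1) : wedge x = 0 ->
  wedge2 (sigma1 sig (sigma2 sig (tassoc (x ⊗ r)))) = 0.
Proof.
have wedge2_sigma2 : forall z : bmod K X3, wedge2 (sigma2 sig z) = - wedge2 z.
  have s2 := bimodD (sigma2_bimod sig_bimod).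
  have w2 := bimodD (@wedge2_bimod K).
  apply: (tens_ext (phi := fun t : bmod K X3 => wedge2 (sigma2 sig t))
    (psi := fun t : bmod K X3 => - wedge2 t)) => [s t|s t|m n].
  - by rewrite s2 w2.
  - by rewrite w2 opprD.
  - by rewrite (sigma2_tens sig_bimod) !wedge2_tens wedge_sig (addmapN (tensDr m)).
move=> /ker_wedge[y ->].
rewrite tensDl (bimodD (@tassoc_bimod K X1 X1 X1)) -(sigma1_tens sig_bimod).
rewrite (bimodD (sigma2_bimod sig_bimod)) (bimodD (sigma1_bimod sig_bimod)).
by rewrite (bimodD (@wedge2_bimod K)) sig_braid wedge2_sigma2 addrN.
Qed.

(** Two preimages of a two-form under [wedge] differ by an element of
    ker wedge, so that any bimodule splitting of [wedge] defines the same map. *)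
Lemma braid_extendable : extendable sig.
Proof.
exists (fun x => wedge1 (sigma2 sig (sigma1 sig (tmap (@id Om1) wedge_lift x)))).
  apply: bimod_map_comp (@wedge1_bimod K) _.
  apply: bimod_map_comp (sigma2_bimod sig_bimod) _.
  apply: bimod_map_comp (sigma1_bimod sig_bimod) _.
  exact: tmap_bimod (@bimod_map_id K X1) wedge_lift_bimod.
move=> r s t; rewrite (tmap_tens (@bimod_map_id K X1) wedge_lift_bimod).
apply/eqP; rewrite -subr_eq0 -(bimodB (@wedge1_bimod K)).
rewrite -(bimodB (sigma2_bimod sig_bimod)) -(bimodB (sigma1_bimod sig_bimod)).
rewrite -tensBr wedge1_braid // (bimodB (wedge_bimod_map K)) wedge_liftK.
exact: subrr.
Qed.

(** The induced map on two-forms is again inner: the middle terms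
    sig (r ⊗ theta) ∧ s cancel, so y |-> theta ⊗ y - sig2 (y ⊗ theta) with
    sig2 the braiding induced by sigma1 sigma2. *)
Lemma braid_wedge_compatible : wedge_compatible nab sig.
Proof.
pose sig2 (z : bmod K (gtens Y2 X1)) : bmod K (gtens X1 Y2) :=
  wedge2 (sigma1 sig (sigma2 sig (tassoc (tmap wedge_lift (@id Om1) z)))).
have sig2_bimod : bimod_map sig2.
  apply: bimod_map_comp (@wedge2_bimod K) _.
  apply: bimod_map_comp (sigma1_bimod sig_bimod) _.
  apply: bimod_map_comp (sigma2_bimod sig_bimod) _.
  apply: bimod_map_comp (@tassoc_bimod K X1 X1 X1) _.
  exact: tmap_bimod wedge_lift_bimod (@bimod_map_id K X1).
exists (inner_conn sig2), sig2; split; first exact: inner_connection.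
move=> r s.
have sig2_wedge : sig2 (wedge (r ⊗ s) ⊗ theta)
    = wedge2 (sigma1 sig (sigma2 sig (tassoc ((r ⊗ s) ⊗ theta)))).
  rewrite /sig2 (tmap_tens wedge_lift_bimod (@bimod_map_id K X1)).
  apply/eqP; rewrite -subr_eq0 -(bimodB (@wedge2_bimod K)).
  rewrite -(bimodB (sigma1_bimod sig_bimod)) -(bimodB (sigma2_bimod sig_bimod)).
  rewrite -(bimodB (@tassoc_bimod K X1 X1 X1)) -tensBl wedge2_braid //.
  by rewrite (bimodB (wedge_bimod_map K)) wedge_liftK subrr.
rewrite /inner_conn sig2_wedge !tensBl tensBr (bimodB (@tassoc_bimod K X1 X1 X1)).
rewrite (bimodB (sigma1_bimod sig_bimod)) !(bimodB (@wedge2_bimod K)).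
rewrite !tassoc_tens wedge2_tens (sigma2_tens sig_bimod).
by rewrite -(sigma1_tens sig_bimod) tassoc_tens addrA subrK.
Qed.

End OneForms.
End InnerConnections.

(** * Left-invariant braidings *)

(** The reflections form the set Z/3 with i conjugated by j equal to 2 j - i. *)
Definition rconj (a b : refl) : refl :=
  match a, b with
  | U, U => U | U, V => W | U, W => V
  | V, U => W | V, V => V | V, W => U
  | W, U => V | W, V => U | W, W => W
  end.

(** The product a b c of three reflections; in Z/3 it is i - j + k, while
    [rconj] is (i, j) |-> - i - j. *)
Definition refl3 (a b c : refl) : refl := rconj (rconj a c) b.

Lemma wt_refl3 a b c :
  perm_of_refl (refl3 a b c) = (perm_of_refl a * perm_of_refl b * perm_of_refl c)%g.
Proof.
apply/permP=> -[[|[|[|//]]] i]; case: a b c => [] [] []; apply: val_inj;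
  by rewrite /= !permM !permE.
Qed.

Lemma perm_of_refl2 a : (perm_of_refl a * perm_of_refl a = 1)%g.
Proof. by case: a; rewrite /= tperm2. Qed.

Lemma perm_of_refl_inj : injective perm_of_refl.
Proof.
move=> a b /permP eq_ab; have := (eq_ab pt0, eq_ab pt1).
by case: a b {eq_ab} => [] []; rewrite /= !permE /= => -[].
Qed.

Lemma wt_eq (a b c d : refl) :
  (@wt X2 (a, b) == @wt X2 (c, d)) = (b == refl3 a c d).
Proof.
rewrite -(inj_eq perm_of_refl_inj) wt_refl3 /= -(inj_eq (mulgI (perm_of_refl a))).
by rewrite !mulgA perm_of_refl2 !mul1g.
Qed.

Lemma wt_refl3_pair (a c d : refl) : @wt X2 (a, refl3 a c d) = @wt X2 (c, d).
Proof. by apply/eqP; rewrite wt_eq. Qed.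

Section ConstantBraidings.
Variable K : fieldType.
Local Notation theta := (theta K).
Local Notation Om1 := (Omega1 K).
Local Notation Om11 := (Omega11 K).
Local Notation e := (e K).

(** The map sending e_a ⊗ e_b to the sum of the M a c d e_c ⊗ e_d over
    all c, d with c d = a b: given a, the condition reads b = a c d, which is why
    only the first factor a is summed over when reading off the coefficient
    of e_c ⊗ e_d. *)
Definition sig_of (M : refl -> refl -> refl -> K) (x : Om11) : Om11 :=
  [ffun p : X2 =>
    [ffun g => \sum_(a : refl) x (a, refl3 a p.1 p.2) g * M a p.1 p.2]].

Lemma sig_ofE M x c d g :
  sig_of M x (c, d) g = \sum_(a : refl) x (a, refl3 a c d) g * M a c d.
Proof. by rewrite ffunE ffunE. Qed.

Lemma sig_of_bimod M : bimod_map (sig_of M).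
Proof.
split=> [x y|f x|x f]; apply: bmodP => -[c d] g.
- rewrite bmodDE !sig_ofE -big_split; apply: eq_bigr => a _.
  by rewrite bmodDE mulrDl.
- rewrite bmodZE !sig_ofE mulr_sumr; apply: eq_bigr => a _.
  by rewrite bmodZE mulrA.
- rewrite ractE !sig_ofE mulr_suml; apply: eq_bigr => a _.
  by rewrite ractE wt_refl3_pair mulrAC.
Qed.

Lemma e_theta a p g : (e a ⊗ theta) p g = (p.1 == a)%:R.
Proof. by rewrite tensE thetaE mulr1 eltE. Qed.

Lemma theta_e a p g : (theta ⊗ e a) p g = (p.2 == a)%:R.
Proof. by rewrite tensE thetaE mul1r eltE. Qed.

Lemma lact_e h a : lact_S3 h (e a) = e a.
Proof. by apply: bmodP => b g; rewrite ffunE ffunE !eltE. Qed.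

(** The element sig (e_a ⊗ theta) = theta ⊗ e_a - nab e_a has constant
    coefficients, and its coefficient at e_c ⊗ e_d comes from the only
    e_a ⊗ e_b of the same weight. *)
Lemma left_invariant_braiding (nab : Om1 -> Om11) sig :
    bimod_connection nab sig -> left_invariant nab ->
  exists M, sig = sig_of M.
Proof.
move=> conn inv; have sig_bimod := conn_braiding conn.
pose M a c d := sig (e a ⊗ theta) (c, d) 1%g.
have sig_cst a c d g : sig (e a ⊗ theta) (c, d) g = M a c d.
  have nab_cst : nab (e a) (c, d) g = nab (e a) (c, d) 1%g.
    by rewrite -{1}(lact_e g) inv lactE mulVg.
  move: nab_cst; rewrite !(connection_inner conn) !bmodBE !theta_e.
  by move/addrI/oppr_inj.
have sig0 a b c d g : b != refl3 a c d -> sig (elt K ((a, b) : X2)) (c, d) g = 0.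
  move=> ne; rewrite (bimod_map_weight sig_bimod) ?ffunE //.
  by rewrite wt_eq.
have sig_elt a c d g : sig (elt K ((a, refl3 a c d) : X2)) (c, d) g = M a c d.
  rewrite -(sig_cst _ _ _ g) (bimod_map_sum sig_bimod (_ ⊗ _)).
  rewrite (bigD1 (a, refl3 a c d)) //= e_theta eqxx mul1r big1 ?addr0 //.
  move=> [a' b]; rewrite xpair_eqE e_theta /=.
  case: eqP => [->/=|_ _]; last by rewrite mul0r.
  by move=> /sig0 ->; rewrite mulr0.
exists M; apply/funext => x; apply: bmodP => -[c d] g.
rewrite sig_ofE (bimod_map_sum sig_bimod).
pose F a b := x (a, b) g * sig (elt K ((a, b) : X2)) (c, d) g.
rewrite (eq_bigr (fun p => F p.1 p.2)) => [|[] //]; rewrite -(pair_bigA _ F).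
apply: eq_bigr => a _; rewrite (bigD1 (refl3 a c d)) //= /F sig_elt big1 ?addr0 //.
by move=> b /sig0 ->; rewrite mulr0.
Qed.

Lemma sig_of_left_invariant M : left_invariant (inner_conn (sig_of M)).
Proof.
move=> h w; apply: bmodP => -[c d] g.
rewrite bmodBE sig_ofE lactE bmodBE sig_ofE !tensE !thetaE !mul1r lactE mulgA.
congr (_ - _); apply: eq_bigr => a _.
by rewrite !tensE !thetaE !mulr1 lactE.
Qed.

Lemma sigma1E M x c d f g : sigma1 (sig_of M) x (c, (d, f)) g
  = \sum_(a : refl) x (a, (refl3 a c d, f)) g * M a c d.
Proof.
rewrite -(tassocVK x); move: (tassocV x) => {x}.
apply: (tens_ext
  (phi := fun t => sigma1 (sig_of M) (tassoc t) (c, (d, f)) g)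
  (psi := fun t => \sum_(a : refl) tassoc t (a, (refl3 a c d, f)) g * M a c d)).
- move=> x y; rewrite (bimodD (@tassoc_bimod K X1 X1 X1)).
  by rewrite (bimodD (sigma1_bimod (sig_of_bimod M))) bmodDE.
- move=> x y; rewrite -big_split; apply: eq_bigr => a _.
  by rewrite (bimodD (@tassoc_bimod K X1 X1 X1)) bmodDE mulrDl.
- move=> x w; rewrite (sigma1_tens (sig_of_bimod M)) ffunE tensE sig_ofE mulr_suml.
  by apply: eq_bigr => a _; rewrite ffunE tensE wt_refl3_pair mulrAC.
Qed.

Lemma sigma2E M (x : bmod K X3) c d f g : sigma2 (sig_of M) x (c, (d, f)) g
  = \sum_(a : refl) x (c, (a, refl3 a d f)) g * M a d f.
Proof.
move: x; apply: (tens_ext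
  (phi := fun x : bmod K X3 => sigma2 (sig_of M) x (c, (d, f)) g)
  (psi := fun x : bmod K X3 =>
     \sum_(a : refl) x (c, (a, refl3 a d f)) g * M a d f)).
- by move=> x y; rewrite (bimodD (sigma2_bimod (sig_of_bimod M))) bmodDE.
- move=> x y; rewrite -big_split; apply: eq_bigr => a _.
  by rewrite bmodDE mulrDl.
- move=> w x; rewrite (sigma2_tens (sig_of_bimod M)) tensE sig_ofE mulr_sumr.
  by apply: eq_bigr => a _; rewrite tensE mulrA.
Qed.

(** For distinct a, b, c the group products ab, bc, ca are equal, and the degree
    two relation says that e_a ∧ e_b + e_b ∧ e_c + e_c ∧ e_a = 0. *)
Lemma wedge_eq0P (x : Om11) : wedge x = 0 <->
  forall a b c, uniq [:: a; b; c] -> x (a, b) = x (b, c).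
Proof.
split=> [/ffunP x0 a b c|xE].
  have := (x0 UV, x0 VW, x0 VU, x0 WV); rewrite !ffunE => -[[[]]].
  move=> /subr0_eq x1 /subr0_eq x2 /subr0_eq x3 /subr0_eq x4.
  by case: a b c => [] [] [] // _; rewrite ?x1 ?x2 ?x3 ?x4.
apply/ffunP=> p; rewrite !ffunE; case: p; apply/eqP; rewrite subr_eq0.
- by rewrite -(xE W U V).
- by rewrite (xE V W U).
- by rewrite (xE V U W).
- by rewrite -(xE U W V).
Qed.

Lemma wedge1_eq0 (x : bmod K X3) a b c f g : wedge1 x = 0 -> uniq [:: a; b; c] ->
  x (a, (b, f)) g = x (b, (c, f)) g.
Proof.
pose slice (z : bmod K X3) : Om11 := [ffun p : X2 => z (p.1, (p.2, f))].
have sliceD y z : slice (y + z) = slice y + slice z.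
  by apply/ffunP=> p; rewrite !ffunE.
have wedge1E z p : wedge1 z (p, f) = wedge (slice z) p.
  rewrite -(tassocVK z); move: (tassocV z) => {z}.
  apply: (tens_ext (phi := fun t => wedge1 (tassoc t) (p, f))
                   (psi := fun t => wedge (slice (tassoc t)) p)) => [y z|y z|y w].
  - rewrite (bimodD (@tassoc_bimod K X1 X1 X1)) (bimodD (@wedge1_bimod K)).
    by rewrite ffunE.
  - rewrite (bimodD (@tassoc_bimod K X1 X1 X1)) sliceD.
    by rewrite (bimodD (wedge_bimod_map K)) ffunE.
  - have -> : slice (tassoc (y ⊗ w)) = ract y (w f).
      by apply: bmodP => -[c' d] h; rewrite ffunE ffunE tensE ractE.
    rewrite wedge1_tens wedge_ract.
    by apply/ffunP=> h; rewrite tensE ractE.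
move=> x0 abc; have : wedge (slice x) = 0.
  by apply/ffunP=> p; rewrite -wedge1E x0 !ffunE.
by move/wedge_eq0P/(_ a b c abc)/(congr1 (fun u : fn K => u g)); rewrite !ffunE.
Qed.

End ConstantBraidings.

(** * The braiding of a primitive cube root of unity *)

Section CubeRoot.
Variables (K : fieldType) (q : K).
Hypotheses (q_neq1 : q != 1) (q_root : q ^+ 2 + q + 1 = 0).
Local Notation Om11 := (Omega11 K).

(** The factor 1 / (1 - q) of the braiding is kept apart so that the values are
    powers of q. *)
Definition coefq (a c d : refl) : K :=
  if c == d then (if a == c then 1 else q^-1) else (if a == c then q else 1).

Definition sigq := sig_of (fun a c d => (1 - q)^-1 * coefq a c d).

Lemma q_sq : q ^+ 2 = - q - 1.
Proof. by apply/eqP; rewrite -subr_eq0 opprB opprK [1 + q]addrC addrA q_root. Qed.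

Lemma q_inv : q^-1 = - q - 1.
Proof.
have q0 : q != 0.
  apply/eqP=> q0; move: q_root; rewrite q0 expr2 mulr0 !add0r.
  by move/eqP; rewrite oner_eq0.
by apply: (mulfI q0); rewrite mulfV //; ring: q_sq.
Qed.

Lemma subq_neq0 : 1 - q != 0.
Proof. by rewrite subr_eq0 eq_sym. Qed.

(** The 27 coefficients of the two sides agree modulo q^2 + q + 1; the common
    factor (1 - q)^-3 is left abstract. *)
Lemma sigq_braid : braid_relations sigq.
Proof.
move=> x; apply: bmodP => -[c [d f]] g.
rewrite sigma1E sigma2E !refl_sum !sigma1E !sigma2E !refl_sum !sigma1E !sigma2E.
rewrite !refl_sum /coefq q_inv; move: (1 - q)^-1 => t.
by case: c d f => [] [] [] /=; ring: q_sq.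
Qed.

Lemma wedge_sigq x : wedge (sigq x) = - wedge x.
Proof.
apply/eqP; rewrite -addr_eq0 -(bimodD (wedge_bimod_map K)); apply/eqP.
apply/wedge_eq0P => a b c abc; apply/ffunP=> g.
rewrite !bmodDE !sig_ofE !refl_sum /coefq; have subq := subq_neq0.
by case: a b c abc => [] [] [] //= _; field.
Qed.

(** On the kernel of [wedge] the braiding has the eigenvalues - q and - q^2,
    the two roots of z^2 - z + 1. *)
Lemma sigq_ker x : wedge x = 0 -> sigq (sigq x) = sigq x - x.
Proof.
move=> /wedge_eq0P xE; have subq := subq_neq0.
apply: bmodP => -[c d] g; rewrite bmodBE !sig_ofE !refl_sum !sig_ofE !refl_sum.
rewrite /coefq q_inv.
have x1 := xE U V W isT; have x2 := xE V W U isT.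
have x3 := xE V U W isT; have x4 := xE U W V isT.
by case: c d => [] [] /=; rewrite ?x1 ?x2 ?x3 ?x4; field: q_sq.
Qed.

Lemma three_neq0 : 3%:R != 0 :> K.
Proof.
apply/eqP=> three0; have /eqP : (1 - q) ^+ 2 = 0.
  have -> : (1 - q) ^+ 2 = - q * 3%:R by ring: q_sq.
  by rewrite three0 mulr0.
by rewrite expf_eq0 (negPf subq_neq0).
Qed.

(** Since z^2 - z + 1 = 0 implies (1 + z) (2 - z) = 3, the preimage is
    (2 - sig) x / 3. *)
Lemma sigq_ker_im x : wedge x = 0 -> exists y, x = y + sigq y.
Proof.
move=> x0; exists (cst 3%:R^-1 *: (x + x - sigq x)).
have sq := sig_of_bimod (fun a c d => (1 - q)^-1 * coefq a c d).
rewrite -/sigq in sq.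
rewrite (bimodZ sq) (bimodB sq) (bimodD sq) sigq_ker // -scalerDr.
apply: bmodP => p g; rewrite bmodZE ffunE !(bmodDE, bmodNE).
field; exact: three_neq0.
Qed.

Lemma cstE (c : K) g : cst c g = c.
Proof. by rewrite ffunE. Qed.

Lemma sigq_e a b c d g : sigq (e K a ⊗ e K b) (c, d) g
  = (b == refl3 a c d)%:R * ((1 - q)^-1 * coefq a c d).
Proof.
rewrite sig_ofE (bigD1 a) //= big1 => [|a' /negPf ne]; rewrite tensE !eltE /=.
  by rewrite eqxx mul1r addr0 eq_sym.
by rewrite ne !mul0r.
Qed.

Lemma given_by_sigq : given_by q (inner_conn sigq) sigq.
Proof.
have subq := subq_neq0.
have q_opp : (q - 1)^-1 = - (1 - q)^-1 by rewrite -invrN opprB.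
split=> [a b c abc|||||||||]; apply: bmodP => -[d f] g; last 9 first.
1-9: rewrite sigq_e !(bmodZE, bmodDE) !tensE !eltE !cstE /coefq.
1-9: by case: d f => [] []; rewrite /= ?(mul0r, mul1r, mulr0, mulr1, addr0, add0r).
rewrite bmodBE theta_e sig_ofE refl_sum !e_theta !(bmodZE, bmodDE, tensE).
rewrite !eltE !cstE /coefq q_inv q_opp.
case: a b c abc => [] [] [] //= _; case: d f => [] [];
  rewrite /= ?(mul0r, mulr0, addr0, add0r) //; by field: q_sq.
Qed.

End CubeRoot.

(** * Classification *)

Lemma uniq_rot3 (a b c : refl) : uniq [:: a; b; c] -> uniq [:: c; a; b].
Proof. by case: a b c => [] [] []. Qed.

Lemma uniq_rconj (a b : refl) : a != b -> uniq [:: a; b; rconj a b].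
Proof. by case: a b => [] []. Qed.

Lemma uniq_swap3 (a b c : refl) : uniq [:: a; b; c] -> uniq [:: b; a; c].
Proof. by case: a b c => [] [] []. Qed.

Section Classification.
Variable K : fieldType.
Variable M : refl -> refl -> refl -> K.
Local Notation sig := (sig_of M).
Hypothesis tors : torsion_free (inner_conn sig).
Hypothesis ext : extendable sig.

(** On the class of (a, b), (b, c), (c, a) the relation wedge (1 + sig) = 0 makes
    M a d d' + [a = d] constant. *)
Lemma torsion_coef a b c : uniq [:: a; b; c] ->
  M a b c = M a a b + 1 /\ M a c a = M a a b + 1.
Proof.
have sig_e c' d' : sig (e K a ⊗ theta K) (c', d') 1%g = M a c' d'.
  rewrite sig_ofE (bigD1 a) //= e_theta eqxx mul1r big1 ?addr0 // => a' /negPf ne.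
  by rewrite e_theta /= ne mul0r.
have tors_a : wedge (sig (e K a ⊗ theta K) + e K a ⊗ theta K) = 0.
  rewrite (bimodD (wedge_bimod_map K)); apply/eqP; rewrite addr_eq0; apply/eqP.
  by case: (torsion_free_inner (sig_of M)) => [tf _]; apply: tf.
have coef b1 b2 b3 : uniq [:: b1; b2; b3] ->
    M a b1 b2 + (b1 == a)%:R = M a b2 b3 + (b2 == a)%:R.
  move/wedge_eq0P: tors_a => /[apply] /(congr1 (fun u : fn K => u 1%g)).
  by rewrite !bmodDE !sig_e !e_theta.
move=> abc; have := coef _ _ _ abc; have := coef _ _ _ (uniq_rot3 abc).
have [ba ca] : (b == a) = false /\ (c == a) = false.
  by case: a b c abc {sig_e tors_a coef} => [] [] [].
by rewrite ba ca eqxx !addr0 => -> <-.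
Qed.

(** The coefficient of e_b ⊗ e_c ⊗ e_d in sigma2 sigma1 (e_a ⊗ x), for x with
    constant coefficients; k is the middle leg between the two braidings. *)
Definition extcoef (x : Omega11 K) a b c d : K :=
  \sum_(k : refl) x (refl3 a b k, refl3 k c d) 1%g * (M a b k * M k c d).

Lemma ext_coef (x : Omega11 K) a b c d f :
    (forall p g h, x p g = x p h) -> wedge x = 0 -> uniq [:: b; c; d] ->
  extcoef x a b c f = extcoef x a c d f.
Proof.
move=> x_cst x0 bcd; case: ext => sig2 sig2_bimod sig2E.
have sb := sig_of_bimod M.
have z0 : wedge1 (sigma2 sig (sigma1 sig (e K a ⊗ x))) = 0.
  transitivity (sig2 (e K a ⊗ wedge x)).
    pose lhs (y : Omega11 K) := sig2 (e K a ⊗ wedge y).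
    pose rhs (y : Omega11 K) := wedge1 (sigma2 sig (sigma1 sig (e K a ⊗ y))).
    symmetry; apply: (tens_ext (phi := lhs) (psi := rhs)) => [y z|y z|r s].
    - by rewrite /lhs (bimodD (wedge_bimod_map K)) tensDr (bimodD sig2_bimod).
    - rewrite /rhs tensDr (bimodD (sigma1_bimod sb)) (bimodD (sigma2_bimod sb)).
      by rewrite (bimodD (@wedge1_bimod K)).
    - exact: sig2E.
  by rewrite x0 (addmap0 (tensDr _)) (addmap0 (bimodD sig2_bimod)).
have zE b' c' : sigma2 sig (sigma1 sig (e K a ⊗ x)) (b', (c', f)) 1%g
    = extcoef x a b' c' f.
  rewrite sigma2E; apply: eq_bigr => k _; rewrite sigma1E (bigD1 a) //= big1.
    rewrite addr0 tensE eltE eqxx mul1r mulrA; congr (_ * _ * _).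
    exact: x_cst.
  by move=> a' /negPf ne; rewrite tensE eltE ne !mul0r.
by rewrite -!zE; apply: wedge1_eq0.
Qed.

(** For x = e_b ⊗ e_b only one middle leg contributes to each coefficient, so
    that the equations are between monomials. *)
Lemma ext_square a b c : uniq [:: a; b; c] ->
  [/\ M a a b * M b b b = M a c a * M a a b
    & M a a c * M c b b = M a b a * M a c b].
Proof.
move=> abc.
have xcst d (p : X2) g h : (e K d ⊗ e K d) p g = (e K d ⊗ e K d) p h.
  by rewrite !tensE !eltE.
have [w0 _ _] := wedge_rel K.
have := ext_coef a b (xcst b) (w0 b) (uniq_rot3 abc).
have := ext_coef a b (xcst c) (w0 c) abc.
rewrite /extcoef !refl_sum !tensE !eltE.
by case: a b c abc => [] [] [] //= _;
  rewrite ?(mul0r, mul1r, mulr0, addr0, add0r) => -> <-.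
Qed.

(** For x = e_b ⊗ e_a + e_c ⊗ e_b + e_a ⊗ e_c every middle leg contributes: this
    is an entry of the flatness equation M_a M_b = M_b M_c for the matrices
    M_d = (M i d j)_(i, j). *)
Lemma ext_mixed a b c : uniq [:: a; b; c] ->
  \sum_(k : refl) M a a k * M k b a = \sum_(k : refl) M a b k * M k c a.
Proof.
pose x := e K b ⊗ e K a + e K c ⊗ e K b + e K a ⊗ e K c.
have xE p g : x p g = ((p.1 == b) && (p.2 == a))%:R
    + ((p.1 == c) && (p.2 == b))%:R + ((p.1 == a) && (p.2 == c))%:R.
  by rewrite !bmodDE !tensE !eltE -!natrM !mulnb.
have xcst p g h : x p g = x p h by rewrite !xE.
move=> abc; have x0 : wedge x = 0.
  apply/wedge_eq0P => b1 b2 b3 b123; apply/ffunP=> g; rewrite !xE.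
  clear x xE xcst; case: a b c abc => [] [] [] // _;
    by case: b1 b2 b3 b123 => [] [] [] //= _; rewrite ?(addr0, add0r).
have := ext_coef a a xcst x0 abc; rewrite /extcoef !refl_sum !xE.
clear x xE xcst x0; case: a b c abc => [] [] [] //= _;
  by rewrite ?(mul0r, mul1r, mulr0, addr0, add0r).
Qed.

(** Up to the nonzero factor M a a b, the first equation of [ext_square] says
    that the off-diagonal unknowns are diagonal coefficients. The factor is
    nonzero because, with b and c exchanged, M a a b = 0 would turn the second
    equation into 0 = 1. *)
Lemma diag_coef a b c : uniq [:: a; b; c] ->
  [/\ M b b b != 1, M a a b = M b b b - 1, M a b c = M b b b
    & M a c a = M b b b].
Proof.
move=> abc; have [t1 t2] := torsion_coef abc.
have [sq1 _] := ext_square abc.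
have [_ sq2] := ext_square (uniq_swap3 (uniq_rot3 abc)).
have nz : M a a b != 0.
  apply: contra_eq_neq sq2 => z; rewrite z mul0r t1 t2 z add0r mulr1 eq_sym.
  exact: oner_neq0.
have dE : M b b b = M a a b + 1 by apply: (mulfI nz); rewrite sq1 t2 mulrC.
by rewrite t1 t2 dE addrK; split=> //; rewrite -subr_eq0 addrK.
Qed.

Lemma square_coef a b c : uniq [:: a; b; c] ->
  (M a a a - 1) * M a b b = M a a a ^+ 2.
Proof.
move=> abc; have [_ sq] := ext_square (uniq_rot3 (uniq_swap3 abc)).
have [_ d1 d2 d3] := diag_coef (uniq_rot3 abc).
by rewrite -d1 sq d2 d3 expr2.
Qed.

Lemma mixed_coef a b c : uniq [:: a; b; c] ->
  M a a a * M c c c + (M a a a - 1) ^+ 2 + M b b b * (M a a a - 1) = 0.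
Proof.
move=> abc; have sumE (F : refl -> K) : \sum_k F k = F a + F b + F c.
  by rewrite refl_sum; case: a b c abc => [] [] [] //= _; ring.
have cab := uniq_rot3 abc; have bca := uniq_rot3 cab.
have bac := uniq_swap3 abc; have cba := uniq_rot3 bac.
have acb := uniq_swap3 cab; have square := square_coef abc.
have := ext_mixed abc; rewrite !sumE.
have [_ Maab Mabc Maca] := diag_coef abc; have [_ Mbba _ _] := diag_coef bac.
have [_ Maac _ Maba] := diag_coef acb; have [_ _ Mcba _] := diag_coef cba.
have [_ _ Mbca _] := diag_coef bca; have [_ Mcca _ _] := diag_coef cab.
rewrite Maab Mabc Maca Maac Maba Mbba Mbca Mcca Mcba => /eqP.
rewrite -subr_eq0 => /eqP mix.
(* M a b b is eliminated with [square_coef]. *)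
pose off := (M a a a - 1) * M a b b - M a a a ^+ 2.
transitivity ((1 - M a a a) * 0 - M c c c * off).
  by rewrite -mix /off; ring.
by rewrite /off square subrr !mulr0 subrr.
Qed.

(** Exchanging b and c in [mixed_coef] changes its left-hand side by
    M b b b - M c c c. *)
Lemma diag_coef_eq a b c : uniq [:: a; b; c] -> M b b b = M c c c.
Proof.
move=> abc; apply/eqP; rewrite -subr_eq0; apply/eqP.
pose mix b c := M a a a * M c c c + (M a a a - 1) ^+ 2 + M b b b * (M a a a - 1).
transitivity (mix c b - mix b c); first by rewrite /mix; ring.
by rewrite /mix !mixed_coef ?subrr //; exact: uniq_swap3 (uniq_rot3 abc).
Qed.

Lemma coef_classification : exists q : K,
  [/\ q != 1, q ^+ 2 + q + 1 = 0
    & forall a c d, M a c d = (1 - q)^-1 * coefq q a c d].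
Proof.
pose t := M U U U; have UVW : uniq [:: U; V; W] by [].
have diagE a : M a a a = t.
  case: a => //; first by rewrite -(@diag_coef_eq W U V).
  by rewrite -(@diag_coef_eq V U W).
have t_root : 3%:R * t ^+ 2 - 3%:R * t + 1 = 0.
  by have := mixed_coef UVW; rewrite !diagE => <-; ring.
have t_neq0 : t != 0.
  apply: contra_eq_neq t_root => ->.
  by rewrite expr2 !mulr0 subr0 add0r oner_neq0.
have t_neq1 : t - 1 != 0.
  by have [] := diag_coef UVW; rewrite diagE subr_eq0.
pose q := 1 - t^-1; have subqV : (1 - q)^-1 = t by rewrite /q subKr invrK.
have q_root : q ^+ 2 + q + 1 = 0.
  apply: (mulfI (x := t ^+ 2)); first by rewrite expf_neq0.
  by rewrite mulr0 -t_root /q; field.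
have tq : t * q = t - 1 by rewrite /q; field.
exists q; split=> // [|a c d].
  by rewrite /q -subr_eq0 addrAC subrr add0r oppr_eq0 invr_eq0.
rewrite subqV /coefq.
case: eqVneq => [<-|cd]; case: eqVneq => [ac|ac].
- by rewrite mulr1 ac diagE.
- apply: (mulfI t_neq1).
  rewrite -{1}(diagE a) (square_coef (uniq_rconj ac)) diagE.
  have q0 : q != 0.
    by apply: contra_eq_neq q_root => ->; rewrite expr2 mulr0 !add0r oner_neq0.
  by rewrite -tq; field.
- by rewrite ac; have [_ -> _ _] := diag_coef (uniq_rconj cd); rewrite diagE tq.
- rewrite mulr1; case: (eqVneq a d) => [<-|ad].
    have [_ _ _ ->] := diag_coef (uniq_swap3 (uniq_rot3 (uniq_rconj ac))).
    by rewrite diagE.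
  have acd : uniq [:: a; c; d] by rewrite /= !inE negb_or ac ad cd.
  by have [_ _ -> _] := diag_coef acd; rewrite diagE.
Qed.

End Classification.

Lemma sigq_inj (K : fieldType) (q q' : K) : sigq q = sigq q' -> q = q'.
Proof.
move=> /(congr1 (fun s : Omega11 K -> Omega11 K => s (e K U ⊗ e K U) (U, U) 1%g)).
by rewrite !sigq_e /coefq /= !mul1r !mulr1 => /invr_inj /addrI /oppr_inj ->.
Qed.

Lemma sigq_properties (K : fieldType) (q : K) : q != 1 -> q ^+ 2 + q + 1 = 0 ->
  let nab := inner_conn (sigq q) in
  [/\ bimod_connection nab (sigq q) /\ left_invariant nab /\ flat nab /\
        torsion_free nab /\ braid_relations (sigq q) /\ extendable (sigq q),
      wedge_compatible nab (sigq q)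
    & leibniz_compatible nab (sigq q)].
Proof.
move=> q1 q_root nab.
have bim : bimod_map (sigq q) by apply: sig_of_bimod.
have braid := sigq_braid q_root.
have ker := sigq_ker_im q1 q_root; have wed := wedge_sigq q1.
have ext := braid_extendable bim braid ker wed.
split; last exact: braid_leibniz.
  split; first exact: inner_connection.
  split; first exact: sig_of_left_invariant.
  split; first exact: extendable_flat.
  by split=> //; apply/torsion_free_inner => w; rewrite wed.
exact: braid_wedge_compatible.
Qed.

Lemma connection_classification (K : fieldType)
    (nab : Omega1 K -> Omega11 K) (sig : Omega11 K -> Omega11 K) :
    bimod_connection nab sig -> left_invariant nab -> torsion_free nab ->
    extendable sig ->
  exists q, [/\ q != 1, q ^+ 2 + q + 1 = 0
              & (nab, sig) = (inner_conn (sigq q), sigq q)].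
Proof.
move=> conn inv tors ext; have nabE := connection_inner conn.
have [M sigM] := left_invariant_braiding conn inv; rewrite sigM in nabE ext *.
have nabE' : nab = inner_conn (sig_of M) by apply/funext.
rewrite nabE' in tors *.
have [q [q1 q_root ME]] := coef_classification tors ext.
exists q; split=> //; suff -> : sig_of M = sigq q by [].
by congr sig_of; do 3! apply/funext => ?; apply: ME.
Qed.

(** * The two complex connections *)

Section Expi.
Variable R : realType.

Lemma expiD (s t : R) : expi (s + t) = expi s * expi t.
Proof.
by apply/eqP; rewrite eq_complex /= cosD sinD eqxx /= addrC [cos s * _]mulrC eqxx.
Qed.

Lemma expi0 : expi 0 = 1 :> R[i].
Proof. by rewrite /expi cos0 sin0. Qed.

Lemma expi_third : let x : R := 2 * pi / 3 in
  [/\ expi x != 1, expi x ^+ 2 + expi x + 1 = 0, expi x * expi (- x) = 1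
    & expi x != expi (- x)].
Proof.
move=> x; have sinx : 0 < sin x.
  apply: sin_gt0_pi; have pi0 := pi_gt0 R.
  by rewrite /x; apply/andP; split; lra.
have eN : expi x * expi (- x) = 1 by rewrite -expiD subrr expi0.
have e3 : expi x ^+ 3 = 1.
  rewrite !exprS expr0 mulr1 -!expiD.
  have -> : x + (x + x) = pi *+ 2 by rewrite /x; field.
  by rewrite /expi cos2pi sin2pi.
have e1 : expi x != 1 by rewrite eq_complex /= (gt_eqF sinx) andbF.
split=> //.
  have : (expi x - 1) * (expi x ^+ 2 + expi x + 1) = 0.
    by transitivity (expi x ^+ 3 - 1); [ring | rewrite e3 subrr].
  by move/eqP; rewrite mulf_eq0 subr_eq0 (negPf e1) => /eqP.
rewrite eq_complex /= sinN negb_and -[sin x == _]subr_eq0 opprK.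
by rewrite [sin x + _ == _]gt_eqF ?orbT // addr_gt0.
Qed.

End Expi.

(* Extendability is part of the classified class: without it the two
   connections are not the only ones. With theta = e_u + e_v + e_w,
   nabla e_a = e_a ⊗ theta + theta ⊗ e_a - 1/3 theta ⊗ theta
   satisfies all the other conditions but is not extendable. *)
Theorem proposition6p2 (R : realType) :
  exists (nabP nabM : Omega1 R[i] -> Omega11 R[i])
         (sigP sigM : Omega11 R[i] -> Omega11 R[i]),
  [/\ (nabP, sigP) <> (nabM, sigM),
      forall (nab : Omega1 R[i] -> Omega11 R[i])
             (sig : Omega11 R[i] -> Omega11 R[i]),
        (bimod_connection nab sig /\ left_invariant nab /\ flat nab /\
         torsion_free nab /\ braid_relations sig /\ extendable sig) <->
        ((nab, sig) = (nabP, sigP) \/ (nab, sig) = (nabM, sigM)),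
      given_by (expi (2 * pi / 3)) nabP sigP /\
      given_by (expi (- (2 * pi / 3))) nabM sigM,
      [/\ extendable sigP, wedge_compatible nabP sigP
        & leibniz_compatible nabP sigP]
    & [/\ extendable sigM, wedge_compatible nabM sigM
        & leibniz_compatible nabM sigM]].
Proof.
have [p1 p_root pm p_neq_m] := expi_third R.
set p := expi (2 * pi / 3) in p1 p_root pm p_neq_m *.
set m := expi _ in pm p_neq_m *.
have p0 : p != 0 by apply: contra_eq_neq pm => ->; rewrite mul0r eq_sym oner_neq0.
have mE : m = - p - 1.
  by apply: (mulfI p0); rewrite pm mulrBr mulrN -expr2 mulr1 (q_sq p_root); ring.
have m_root : m ^+ 2 + m + 1 = 0 by rewrite -p_root mE; ring.
have m1 : m != 1.
  apply: contraNneq p1 => m1; move: pm; rewrite m1 mulr1 => ->; exact: eqxx.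
have [connP wedgeP leibP] := sigq_properties p1 p_root.
have [connM wedgeM leibM] := sigq_properties m1 m_root.
have [_ [_ [_ [_ [_ extP]]]]] := connP; have [_ [_ [_ [_ [_ extM]]]]] := connM.
exists (inner_conn (sigq p)), (inner_conn (sigq m)), (sigq p), (sigq m).
split.
- move=> /(congr1 snd) /sigq_inj pm_eq.
  by move: p_neq_m; rewrite pm_eq eqxx.
- move=> nab sig; split=> [[conn [li [_ [tors [_ ext]]]]]|].
    have [q [_ q_root ->]] := connection_classification conn li tors ext.
    have : (q - p) * (q - m) = 0 by rewrite -q_root mE; ring: (q_sq p_root).
    move/eqP; rewrite mulf_eq0 !subr_eq0 => /orP[]/eqP ->.
      by left.
    by right.
  case=> nab_sig.
    rewrite [nab](congr1 fst nab_sig) [sig](congr1 snd nab_sig); exact: connP.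
  by rewrite [nab](congr1 fst nab_sig) [sig](congr1 snd nab_sig); exact: connM.
- by split; [exact: given_by_sigq p1 p_root | exact: given_by_sigq m1 m_root].
- by split; [exact: extP | exact: wedgeP | exact: leibP].
- by split; [exact: extM | exact: wedgeM | exact: leibM].
Qed.
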